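(* Let $(M,\mathfrak g,T)$ be an embedding tensor on a Malcev algebra with action $\rho$, and let $\theta:M\to\mathfrak g$, $\omega:\wedge^2\mathfrak g\to\mathfrak g$, $\nu:\mathfrak g\otimes M\to M$ be linear maps. Then $(\theta,\omega,\nu)$ generates a 1-parameter infinitesimal deformation of $(M,\mathfrak g,T)$ if and only if both of the following hold: (i) $(\theta,\omega,\nu)$ is a 2-cocycle of $(M,\mathfrak g,T)$ with coefficients in the adjoint representation, i.e. for all $x,y,z,t\in\mathfrak g$, $m,n\in M$ it satisfies (a1) $[T(m),\theta(n)]+[\theta(m),T(n)]+\omega(T(m),T(n))-T(\rho(\theta(m))(n))-T(\nu(T(m),n))-\theta(\rho(T(m))(n))=0$, (b1) $\omega([x,z],[y,t])+[\omega(x,z),[y,t]]+[[x,z],\omega(y,t)]=\sum_{\mathrm{cyc}}\big(\omega([[x,y],z],t)+[\omega([x,y],z),t]+[[\omega(x,y),z],t]\big)$, (c1) $\nu([[x,y],z],m)+\rho(\omega([x,y],z))(m)+\rho([\omega(x,y),z])(m)-\nu(x,\rho(y)\rho(z)(m))-\rho(x)\nu(y,\rho(z)(m))-\rho(x)\rho(y)\nu(z,m)+\nu(z,\rho(x)\rho(y)(m))+\rho(z)\nu(x,\rho(y)(m))+\rho(z)\rho(x)\nu(y,m)-\nu(y,\rho([z,x])(m))-\rho(y)\nu([z,x],m)-\rho(y)\rho(\omega(z,x))(m)+\nu([y,z],\rho(x)(m))+\rho(\omega(y,z))\rho(x)(m)+\rho([y,z])\nu(x,m)=0$, and moreover the following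 conditions hold: (a2) $[\theta(m),\theta(n)]+\omega(T(m),\theta(n))+\omega(\theta(m),T(n))-T(\nu(\theta(m),n))-\theta(\rho(\theta(m))(n))-\theta(\nu(T(m),n))=0$, (b2) $\omega(\omega(x,z),[y,t])+\omega([x,z],\omega(y,t))+[\omega(x,z),\omega(y,t)]=\sum_{\mathrm{cyc}}\big(\omega(\omega([x,y],z),t)+\omega([\omega(x,y),z],t)+[\omega(\omega(x,y),z),t]\big)$, (c2) $\nu(\omega([x,y],z),m)+\nu([\omega(x,y),z],m)+\rho(\omega(\omega(x,y),z))(m)-\nu(x,\nu(y,\rho(z)(m)))-\nu(x,\rho(y)\nu(z,m))-\rho(x)\nu(y,\nu(z,m))+\nu(z,\nu(x,\rho(y)(m)))+\nu(z,\rho(x)\nu(y,m))+\rho(z)\nu(x,\nu(y,m))-\nu(y,\nu([z,x],m))-\nu(y,\rho(\omega(z,x))(m))-\rho(y)\nu(\omega(z,x),m)+\nu(\omega(y,z),\rho(x)(m))+\nu([y,z],\nu(x,m))+\rho(\omega(y,z))\nu(x,m)=0$; (ii) $(M,\mathfrak g,\theta)$, with bracket $\omega$ on $\mathfrak g$ and action $\nu$ of $\mathfrak g$ on $M$, is an embedding tensor on a Malcev algebra. Here $\sum_{\mathrm{cyc}}$ denotes the sum over the four cyclic permutations of $(x,y,z,t)$, i.e. over $(x,y,z,t),(y,z,t,x),(z,t,x,y),(t,x,y,z)$.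
   Context: All vector spaces and linear maps are over a fixed field $k$ of characteristic $0$. A Malcev algebra is a vector space $\mathfrak g$ with a skew-symmetric bilinear bracket satisfying $J(x,y,[x,z])=[J(x,y,z),x]$ for all $x,y,z$, where $J(x,y,z)=[[x,y],z]+[[y,z],x]+[[z,x],y]$; equivalently (Sagle's identity) $[[x,z],[y,t]]=[[[x,y],z],t]+[[[y,z],t],x]+[[[z,t],x],y]+[[[t,x],y],z]$. A representation of $\mathfrak g$ on a vector space $M$ is a linear map $\rho:\mathfrak g\to\operatorname{End}(M)$ with $\rho([[x,y],z])=\rho(x)\rho(y)\rho(z)-\rho(z)\rho(x)\rho(y)+\rho(y)\rho([z,x])-\rho([y,z])\rho(x)$. An embedding tensor $(M,\mathfrak g,T)$ on a Malcev algebra consists of a Malcev algebra $\mathfrak g$, a representation $(M,\rho)$ of $\mathfrak g$, and a linear map $T:M\to\mathfrak g$ with $[T(m),T(n)]=T(\rho(T(m))(n))$ for all $m,n\in M$. Write $\nu(x,m)=\nu(x)(m)$. For a parameter $\lambda$ put $T_\lambda(m)=T(m)+\lambda\theta(m)$, $[x,y]_\lambda=[x,y]+\lambda\omega(x,y)$, $\rho_\lambda(x)(m)=\rho(x)(m)+\lambda\nu(x,m)$, and let $\mathfrak g_\lambda$ and $M_\lambda$ be $\mathfrak g$ and $M$ with bracket $[\cdot,\cdot]_\lambda$ and action $\rho_\lambda$. The triple $(\theta,\omega,\nu)$ generates a 1-parameter infinitesimal deformation of $(M,\mathfrak g,T)$ if $(M_\lambda,\mathfrak g_\lambda,T_\lambda)$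 is an embedding tensor on a Malcev algebra for all $\lambda$. *)

(* Defs.v *)
From HB Require Import structures.
From mathcomp Require Import all_boot all_order all_algebra.

Set Implicit Arguments.
Unset Strict Implicit.
Unset Printing Implicit Defensive.

Import GRing.Theory.

Local Open Scope ring_scope.

Section MalcevAlgebra.
Variables (k : fieldType) (g : lmodType k).

Definition skew_symmetric (br : g -> g -> g) := forall x y, br x y = - br y x.

(* For a bilinear map this says that it factors through the exterior square *)
Definition alternating (br : g -> g -> g) := forall x, br x x = 0.

Definition jacobian (br : g -> g -> g) (x y z : g) : g :=
  br (br x y) z + br (br y z) x + br (br z x) y.

Definition malcev_algebra (br : {bilinear g -> g -> g}) :=
  skew_symmetric br /\
  forall x y z, jacobian br x y (br x z) = br (jacobian br x y z) x.

(* A linear map [g -> End(M)] is given in curried form, as a bilinear map. *)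
Definition malcev_representation (M : lmodType k) (br : {bilinear g -> g -> g})
    (rho : {bilinear g -> M -> M}) :=
  forall x y z m,
    rho (br (br x y) z) m =
      rho x (rho y (rho z m)) - rho z (rho x (rho y m))
      + rho y (rho (br z x) m) - rho (br y z) (rho x m).

Definition embedding_tensor (M : lmodType k) (br : {bilinear g -> g -> g})
    (rho : {bilinear g -> M -> M}) (T : {linear M -> g}) :=
  [/\ malcev_algebra br, malcev_representation br rho
    & forall m n, br (T m) (T n) = T (rho (T m) n)].

End MalcevAlgebra.

Section Deform.
Variables (k : fieldType) (U V W : lmodType k).

Definition deform2 (lam : k) (f h : {bilinear U -> V -> W}) (u : U) (v : V) : W :=
  f u v + lam *: h u v.

Variables (lam : k) (f h : {bilinear U -> V -> W}).

Fact deform2_is_bilinear :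
  bilinear_for (GRing.Scale.Law.clone _ _ *:%R _)
    (GRing.Scale.Law.clone _ _ *:%R _) (deform2 lam f h).
Proof.
split=> [v|u] a x y /=; rewrite /deform2.
- by rewrite !linearPl !scalerDr !scalerA addrACA mulrC.
- by rewrite !linearPr !scalerDr !scalerA addrACA mulrC.
Qed.

HB.instance Definition _ :=
  bilinear_isBilinear.Build k U V W _ _ (deform2 lam f h) deform2_is_bilinear.

End Deform.

Section InfinitesimalDeformation.
Variables (k : fieldType) (g M : lmodType k).
Variables (br : {bilinear g -> g -> g}) (rho : {bilinear g -> M -> M}).
Variable T : {linear M -> g}.
Variables (theta : {linear M -> g}) (omega : {bilinear g -> g -> g}).
Variable nu : {bilinear g -> M -> M}.

Definition generates_deformation := forall lam : k,
  embedding_tensor (deform2 lam br omega) (deform2 lam rho nu)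
    (T \+ lam \*: theta).

Definition cyclic_sum (F : g -> g -> g -> g -> g) (x y z t : g) : g :=
  F x y z t + F y z t x + F z t x y + F t x y z.

Definition two_cocycle :=
  [/\ forall m n,
        br (T m) (theta n) + br (theta m) (T n) + omega (T m) (T n)
        - T (rho (theta m) n) - T (nu (T m) n) - theta (rho (T m) n) = 0,
      forall x y z t,
        omega (br x z) (br y t) + br (omega x z) (br y t)
        + br (br x z) (omega y t)
        = cyclic_sum (fun x y z t =>
            omega (br (br x y) z) t + br (omega (br x y) z) t
            + br (br (omega x y) z) t) x y z t
    & forall x y z m,
        nu (br (br x y) z) m + rho (omega (br x y) z) m
        + rho (br (omega x y) z) m
        - nu x (rho y (rho z m)) - rho x (nu y (rho z m))
        - rho x (rho y (nu z m))
        + nu z (rho x (rho y m)) + rho z (nu x (rho y m))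
        + rho z (rho x (nu y m))
        - nu y (rho (br z x) m) - rho y (nu (br z x) m)
        - rho y (rho (omega z x) m)
        + nu (br y z) (rho x m) + rho (omega y z) (rho x m)
        + rho (br y z) (nu x m) = 0].

(* The coefficients of [lam ^+ 2] in the identities for the deformed maps,
   [two_cocycle] being those of [lam]. *)
Definition second_order_conditions :=
  [/\ forall m n,
        br (theta m) (theta n) + omega (T m) (theta n) + omega (theta m) (T n)
        - T (nu (theta m) n) - theta (rho (theta m) n)
        - theta (nu (T m) n) = 0,
      forall x y z t,
        omega (omega x z) (br y t) + omega (br x z) (omega y t)
        + br (omega x z) (omega y t)
        = cyclic_sum (fun x y z t =>
            omega (omega (br x y) z) t + omega (br (omega x y) z) t
            + br (omega (omega x y) z) t) x y z t
    & forall x y z m,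
        nu (omega (br x y) z) m + nu (br (omega x y) z) m
        + rho (omega (omega x y) z) m
        - nu x (nu y (rho z m)) - nu x (rho y (nu z m))
        - rho x (nu y (nu z m))
        + nu z (nu x (rho y m)) + nu z (rho x (nu y m))
        + rho z (nu x (nu y m))
        - nu y (nu (br z x) m) - nu y (rho (omega z x) m)
        - rho y (nu (omega z x) m)
        + nu (omega y z) (rho x m) + nu (br y z) (nu x m)
        + rho (omega y z) (nu x m) = 0].

End InfinitesimalDeformation.

(* Main.v *)
Require Import Defs.
From HB Require Import structures.
From mathcomp Require Import all_boot all_order all_algebra.
From mathcomp Require Import ring.

Set Implicit Arguments.
Unset Strict Implicit.
Unset Printing Implicit Defensive.

Import GRing.Theory.

Local Open Scope ring_scope.

(** A triple formed of a skew-symmetric bracket, an action and a linear map is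
    an embedding tensor exactly when three expressions vanish identically: the
    defects of Sagle's identity, of the representation identity and of the
    embedding tensor identity. In each of them every monomial is a composite
    of exactly three of the structure maps, so the defect of the deformed
    triple is a cubic polynomial in the parameter [lam]. Its constant
    coefficient is the defect of the given triple, which is zero; its leading
    coefficient is the defect of (theta, omega, nu), which vanishes when that
    triple is an embedding tensor as well; and its two middle coefficients are
    the cocycle conditions and the second order conditions
    ([sagle_defect_deform], [representation_defect_deform],
    [tensor_defect_deform]). Exchanging the two triples reverses the order of
    the coefficients, so the second order conditions are the cocycle
    conditions of the exchanged pair ([second_order_two_cocycle]). In
    characteristic 0 the values of the parameter at 0, 1, -1 and 2 already
    determine a cubic polynomial with coefficients in a vector space
    ([cubic_eq0]), which gives the equivalence.

    The Malcev identity has to be traded for Sagle's identity first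
    ([malcev_algebraP]), because it is quadratic in [x], while the cocycle
    conditions are the coefficients of the multilinear identity.  Let
    [S x y z t] be the defect of Sagle's identity for a skew-symmetric
    bracket.  It is invariant under cyclic permutations, and [S x y z x] is
    the defect of the Malcev identity.  If the latter vanishes, polarization
    makes [S] change sign when its outer arguments are exchanged, and
    therefore by a 3-cycle of its first three arguments; three such cycles
    give [S = - S], hence [S = 0]. *)

(** * Computing in a module by commutative ring identities *)

(** Nagata's idealization: the square-zero extension of [k] by [V].  It embeds
    [V] in a commutative ring in which scaling becomes multiplication, so that
    module identities can be decided by ring normalization. *)
Definition idealization (k : comNzRingType) (V : lmodType k) : Type :=
  (k * V)%type.

Section Idealization.
Variables (k : comNzRingType) (V : lmodType k).
Local Notation A := (idealization V).

HB.instance Definition _ := GRing.Zmodule.copy A (k * V)%type.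

Definition idealization_one : A := (1, 0).
Definition idealization_mul (p q : A) : A :=
  (p.1 * q.1, p.1 *: q.2 + q.1 *: p.2).

Fact idealization_mulA : associative idealization_mul.
Proof.
move=> [a u] [b v] [c w]; congr pair; rewrite /= ?mulrA //.
by rewrite !scalerDr !scalerA addrA [c * a]mulrC [c * b]mulrC.
Qed.

Fact idealization_mulC : commutative idealization_mul.
Proof. by move=> [a u] [b v]; congr pair; rewrite /= 1?mulrC 1?addrC. Qed.

Fact idealization_mul1 : left_id idealization_one idealization_mul.
Proof.
by move=> [a u]; congr pair; rewrite /= ?mul1r // scale1r scaler0 addr0.
Qed.

Fact idealization_mulD : left_distributive idealization_mul +%R.
Proof.
move=> [a u] [b v] [c w]; congr pair; rewrite /= ?mulrDl //.
by rewrite scalerDl scalerDr addrACA.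
Qed.

Fact idealization_one_neq0 : idealization_one != 0 :> A.
Proof. by apply/eqP => -[] /eqP; rewrite oner_eq0. Qed.

HB.instance Definition _ := GRing.Zmodule_isComNzRing.Build A
  idealization_mulA idealization_mulC idealization_mul1 idealization_mulD
  idealization_one_neq0.

Definition ideal_in (v : V) : A := (0, v).
Definition scalar_in (a : k) : A := (a, 0).

Fact ideal_in_additive : zmod_morphism ideal_in.
Proof. by move=> u v; congr pair; rewrite /= subr0. Qed.
HB.instance Definition _ :=
  GRing.isZmodMorphism.Build V A ideal_in ideal_in_additive.

Lemma ideal_inE :
  (ideal_in 0 = 0) * (forall u v, ideal_in (u + v) = ideal_in u + ideal_in v)
  * (forall v, ideal_in (- v) = - ideal_in v)
  * (forall a v, ideal_in (a *: v) = scalar_in a * ideal_in v).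
Proof.
do !split=> *; rewrite ?raddf0 ?raddfD ?raddfN //.
by congr pair; rewrite /= ?mulr0 // scale0r addr0.
Qed.

Fact scalar_in_additive : zmod_morphism scalar_in.
Proof. by move=> a b; congr pair; rewrite /= subr0. Qed.
HB.instance Definition _ :=
  GRing.isZmodMorphism.Build k A scalar_in scalar_in_additive.

Fact scalar_in_multiplicative : monoid_morphism scalar_in.
Proof. by split=> // a b; congr pair; rewrite /= !scaler0 addr0. Qed.
HB.instance Definition _ :=
  GRing.isMonoidMorphism.Build k A scalar_in scalar_in_multiplicative.

Lemma ideal_in_inj : injective ideal_in.
Proof. by move=> u v []. Qed.

End Idealization.

Section LinearExpansion.
Variables (k : fieldType) (U V W : lmodType k).
Variables (f : {bilinear U -> V -> W}) (h : {linear U -> V}).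

Lemma map_add u v : h (u + v) = h u + h v. Proof. exact: linearD. Qed.
Lemma map_scale a u : h (a *: u) = a *: h u. Proof. exact: linearZ_LR. Qed.
Lemma map_addl u u' v : f (u + u') v = f u v + f u' v.
Proof. exact: linearDl. Qed.
Lemma map_addr u v v' : f u (v + v') = f u v + f u v'.
Proof. exact: linearDr. Qed.
Lemma map_oppl u v : f (- u) v = - f u v. Proof. exact: linearNl. Qed.
Lemma map_oppr u v : f u (- v) = - f u v. Proof. exact: linearNr. Qed.
Lemma map_scalel a u v : f (a *: u) v = a *: f u v.
Proof. exact: linearZl_LR. Qed.
Lemma map_scaler a u v : f u (a *: v) = a *: f u v.
Proof. exact: linearZr_LR. Qed.

End LinearExpansion.

(** Each rewriting step is guided by a syntactic match and uses a lemma
    instantiated completely.  The results then carry the same canonical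
    instances as the source, which [module_ring] relies on to identify equal
    vectors. *)
Ltac expand_linear := repeat match goal with
  | |- context [Bilinear.sort ?f (?u + ?v) ?w] => rewrite (map_addl f u v w)
  | |- context [Bilinear.sort ?f ?w (?u + ?v)] => rewrite (map_addr f w u v)
  | |- context [Bilinear.sort ?f (- ?u) ?w] => rewrite (map_oppl f u w)
  | |- context [Bilinear.sort ?f ?w (- ?u)] => rewrite (map_oppr f w u)
  | |- context [Bilinear.sort ?f (?a *: ?u) ?w] =>
    rewrite (map_scalel f a u w)
  | |- context [Bilinear.sort ?f ?w (?a *: ?u)] =>
    rewrite (map_scaler f a w u)
  | |- context [GRing.Linear.sort ?f (?u + ?v)] => rewrite (map_add f u v)
  | |- context [GRing.Linear.sort ?f (?a *: ?u)] => rewrite (map_scale f a u)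
  end.

(** The vectors left after [ideal_inE] are abstracted before ring
    normalization, which would otherwise interpret the bilinear maps inside
    them as additive functions. *)
Ltac module_ring :=
  apply: ideal_in_inj;
  rewrite ?ideal_inE;
  repeat match goal with |- context [ideal_in ?v] =>
    generalize (ideal_in v); intro end;
  ring.

(** * Cubic polynomials with vector coefficients *)

Section CubicPolynomial.
Variables (k : fieldType) (char_k : [pchar k] =i pred0) (V : lmodType k).

Lemma natr_scale_eq0_char0 n (v : V) : n.+1%:R *: v = 0 -> v = 0.
Proof.
by move/eqP; rewrite scaler_eq0 ((pcharf0P k).1 char_k) => /eqP.
Qed.

Lemma eq_opp_char0 (v : V) : v = - v -> v = 0.
Proof.
move=> vN; apply: (@natr_scale_eq0_char0 1%N).
by rewrite scaler_nat mulr2n {1}vN addNr.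
Qed.

Lemma cubic_eq0 (p0 p1 p2 p3 : V) :
  (forall a : k, p0 + a *: p1 + (a ^+ 2) *: p2 + (a ^+ 3) *: p3 = 0) <->
  [/\ p0 = 0, p1 = 0, p2 = 0 & p3 = 0].
Proof.
split=> [vanish | [-> -> -> ->] a]; last by rewrite !scaler0 !addr0.
have p0_0 : p0 = 0 by rewrite -(vanish 0) !expr0n !scale0r !addr0.
have p2_0 : p2 = 0.
  (* With zero constant term, 2 p2 is the sum of the values at 1 and -1. *)
  apply: (@natr_scale_eq0_char0 1%N); rewrite -[RHS]addr0 -{1}(vanish 1).
  by rewrite -(vanish (-1)) p0_0; module_ring.
have p3_0 : p3 = 0.
  (* What is left is odd: its value at 2 minus twice its value at 1 is
     6 p3. *)
  apply: (@natr_scale_eq0_char0 5%N); rewrite -[RHS]subr0 -{1}(vanish 2%:R).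
  by rewrite -[X in _ - X](scaler0 _ 2%:R) -(vanish 1) p0_0 p2_0; module_ring.
split=> //; rewrite -(vanish 1) p0_0 p2_0 p3_0; module_ring.
Qed.

End CubicPolynomial.

(** * Sagle's form of the Malcev identity *)

Section MalcevIdentity.
Variables (k : fieldType) (char_k : [pchar k] =i pred0) (g : lmodType k).
Implicit Type br : {bilinear g -> g -> g}.

Definition sagle_defect br x y z t :=
  br (br x z) (br y t)
  - cyclic_sum (fun x y z t => br (br (br x y) z) t) x y z t.

(** The cyclic sum is invariant by construction, and skew-symmetry carries
    [[y, t], [z, x]] back to [[x, z], [y, t]] through two changes of sign. *)
Lemma sagle_defect_rot br x y z t : skew_symmetric br ->
  sagle_defect br x y z t = sagle_defect br y z t x.
Proof.
move=> skew; rewrite /sagle_defect /cyclic_sum.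
rewrite (skew (br y t)) (skew z x); expand_linear; module_ring.
Qed.

Lemma skew_alternating br : skew_symmetric br -> alternating br.
Proof.
move=> skew x; apply: (eq_opp_char0 char_k); exact: skew.
Qed.

Lemma alternating_skew br : alternating br -> skew_symmetric br.
Proof.
move=> alt x y; apply/eqP; rewrite -addr_eq0; apply/eqP.
by rewrite -(alt (x + y)) map_addl !map_addr !alt addr0 add0r.
Qed.

(** With [t = x] the term [[[t, x], y], z] of the cyclic sum is zero, and the
    remaining ones are those of the Malcev identity. *)
Lemma sagle_defect_malcev br x y z : skew_symmetric br ->
  sagle_defect br x y z x =
  jacobian br x y (br x z) - br (jacobian br x y z) x.
Proof.
move=> skew; rewrite /sagle_defect /cyclic_sum /jacobian.
rewrite (skew_alternating skew) (skew y (br x z)) (skew y x) (skew z x).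
rewrite (skew (br x y) (br x z)) !linear0l; expand_linear; module_ring.
Qed.

Lemma sagle_defect_polarized br x y z t :
  sagle_defect br (x + t) y z (x + t) =
  sagle_defect br x y z x + sagle_defect br t y z t
  + sagle_defect br x y z t + sagle_defect br t y z x.
Proof. rewrite /sagle_defect /cyclic_sum; expand_linear; module_ring. Qed.

(** For the direct implication, combining the sign change under exchange of the
    outer arguments with a rotation shows that the defect changes sign under a
    3-cycle, a permutation of odd order; so the defect is its own opposite. *)
Lemma malcev_algebraP br : malcev_algebra br <->
  skew_symmetric br /\ forall x y z t, sagle_defect br x y z t = 0.
Proof.
split=> -[skew]; last first.
  move=> sagle; split=> // x y z; apply/subr0_eq.
  by rewrite -sagle_defect_malcev.
move=> malcev; split=> // x y z t.
have ends_eq u v w : sagle_defect br u v w u = 0.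
  by rewrite sagle_defect_malcev // malcev subrr.
have swap u v w s : sagle_defect br u v w s = - sagle_defect br s v w u.
  apply/eqP; rewrite -addr_eq0; apply/eqP.
  by have := sagle_defect_polarized br u v w s; rewrite !ends_eq !add0r.
have cycle3 u v w s : sagle_defect br u v w s = - sagle_defect br v w u s.
  by rewrite swap sagle_defect_rot.
by apply: (eq_opp_char0 char_k); rewrite {1}cycle3 cycle3 cycle3 !opprK.
Qed.

End MalcevIdentity.

(** * Defects of an embedding tensor and their variations *)

Section Defects.
Variables (k : fieldType) (g M : lmodType k).
Implicit Types (br omega : {bilinear g -> g -> g}).
Implicit Types (rho nu : {bilinear g -> M -> M}) (T theta : {linear M -> g}).

Definition tensor_defect br rho T m n := br (T m) (T n) - T (rho (T m) n).

Definition representation_defect br rho x y z m :=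
  rho (br (br x y) z) m
  - (rho x (rho y (rho z m)) - rho z (rho x (rho y m))
     + rho y (rho (br z x) m) - rho (br y z) (rho x m)).

(** The three variations are the derivatives at [lam = 0] of the three defects
    along the deformation.  They are written in the form taken by the cocycle
    conditions. *)
Definition tensor_variation br rho T omega nu theta m n :=
  br (T m) (theta n) + br (theta m) (T n) + omega (T m) (T n)
  - T (rho (theta m) n) - T (nu (T m) n) - theta (rho (T m) n).

Definition sagle_variation br omega x y z t :=
  omega (br x z) (br y t) + br (omega x z) (br y t) + br (br x z) (omega y t)
  - cyclic_sum (fun x y z t =>
      omega (br (br x y) z) t + br (omega (br x y) z) t
      + br (br (omega x y) z) t) x y z t.

Definition representation_variation br rho omega nu x y z m :=
  nu (br (br x y) z) m + rho (omega (br x y) z) m + rho (br (omega x y) z) m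
  - nu x (rho y (rho z m)) - rho x (nu y (rho z m)) - rho x (rho y (nu z m))
  + nu z (rho x (rho y m)) + rho z (nu x (rho y m)) + rho z (rho x (nu y m))
  - nu y (rho (br z x) m) - rho y (nu (br z x) m) - rho y (rho (omega z x) m)
  + nu (br y z) (rho x m) + rho (omega y z) (rho x m)
  + rho (br y z) (nu x m).

(** The coefficient of [a ^+ 2] is the variation with the two triples
    exchanged: choosing the deforming map in two places out of three amounts to
    choosing the given map in one. *)
Lemma tensor_defect_deform a br rho T omega nu theta m n :
  tensor_defect (deform2 a br omega) (deform2 a rho nu) (T \+ a \*: theta) m n =
  tensor_defect br rho T m n
  + a *: tensor_variation br rho T omega nu theta m n
  + a ^+ 2 *: tensor_variation omega nu theta br rho T m n
  + a ^+ 3 *: tensor_defect omega nu theta m n.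
Proof.
(* A plain right-hand side, so that both occurrences of [T p], before and
   after expansion, are syntactically equal. *)
have deformT p :
    ((T \+ a \*: theta) : {linear M -> g}) p = T p + a *: theta p by [].
rewrite /tensor_defect /tensor_variation !deformT /= /deform2.
expand_linear; module_ring.
Qed.

Lemma sagle_defect_deform a br omega x y z t :
  sagle_defect (deform2 a br omega) x y z t =
  sagle_defect br x y z t + a *: sagle_variation br omega x y z t
  + a ^+ 2 *: sagle_variation omega br x y z t
  + a ^+ 3 *: sagle_defect omega x y z t.
Proof.
rewrite /sagle_defect /sagle_variation /cyclic_sum /= /deform2.
expand_linear; module_ring.
Qed.

Lemma representation_defect_deform a br rho omega nu x y z m :
  representation_defect (deform2 a br omega) (deform2 a rho nu) x y z m =
  representation_defect br rho x y z m
  + a *: representation_variation br rho omega nu x y z m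
  + a ^+ 2 *: representation_variation omega nu br rho x y z m
  + a ^+ 3 *: representation_defect omega nu x y z m.
Proof.
rewrite /representation_defect /representation_variation /= /deform2.
expand_linear; module_ring.
Qed.

Lemma embedding_tensorP (char_k : [pchar k] =i pred0) br rho T :
  embedding_tensor br rho T <->
  [/\ skew_symmetric br,
      forall x y z t, sagle_defect br x y z t = 0,
      forall x y z m, representation_defect br rho x y z m = 0
    & forall m n, tensor_defect br rho T m n = 0].
Proof.
split=> [[/(malcev_algebraP char_k)[skew sagle] rep tens] |
         [skew sagle rep tens]].
- split=> // [x y z m | m n]; apply/eqP; rewrite subr_eq0; apply/eqP.
    exact: rep.
  exact: tens.
- split; first exact/malcev_algebraP.
    by move=> x y z m; apply/subr0_eq/rep.
  by move=> m n; apply/subr0_eq/tens.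
Qed.

Lemma two_cocycleP br rho T theta omega nu :
  two_cocycle br rho T theta omega nu <->
  [/\ forall x y z t, sagle_variation br omega x y z t = 0,
      forall x y z m, representation_variation br rho omega nu x y z m = 0
    & forall m n, tensor_variation br rho T omega nu theta m n = 0].
Proof.
split=> [[tens sagle rep] | [sagle rep tens]]; split=> // x y z t.
  by rewrite /sagle_variation sagle subrr.
exact/subr0_eq/sagle.
Qed.

(** The coefficients of degree 2 for one pair of triples are those of degree 1
    for the exchanged pair; only the order of the terms differs. *)
Lemma second_order_two_cocycle br rho T theta omega nu :
  second_order_conditions br rho T theta omega nu <->
  two_cocycle omega nu theta T br rho.
Proof.
split=> -[tens sagle rep]; split=> [m n | x y z t | x y z m].
- by rewrite -[RHS](tens m n); module_ring.
- apply/subr0_eq; have /eqP := sagle x y z t; rewrite -subr_eq0 => /eqP <-.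
  by rewrite /cyclic_sum; module_ring.
- by rewrite -[RHS](rep x y z m); module_ring.
- by rewrite -[RHS](tens m n); module_ring.
- apply/subr0_eq; have /eqP := sagle x y z t; rewrite -subr_eq0 => /eqP <-.
  by rewrite /cyclic_sum; module_ring.
- by rewrite -[RHS](rep x y z m); module_ring.
Qed.

End Defects.

(** * Infinitesimal deformations *)

Theorem theorem5p1 (k : fieldType) (char_k : [pchar k] =i pred0)
    (g M : lmodType k) (br : {bilinear g -> g -> g})
    (rho : {bilinear g -> M -> M}) (T : {linear M -> g})
    (MgT : embedding_tensor br rho T)
    (theta : {linear M -> g}) (omega : {bilinear g -> g -> g})
    (alt_omega : alternating omega) (nu : {bilinear g -> M -> M}) :
  generates_deformation br rho T theta omega nu <->
  (two_cocycle br rho T theta omega nu /\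
   second_order_conditions br rho T theta omega nu) /\
  embedding_tensor omega nu theta.
Proof.
have [skew_br sagle_br rep_br tens_br] :=
  (embedding_tensorP char_k _ _ _).1 MgT.
have skew_omega := alternating_skew alt_omega.
rewrite second_order_two_cocycle !two_cocycleP (embedding_tensorP char_k).
split=> [deform | [[[sagle1 rep1 tens1] [sagle2 rep2 tens2]]
                   [_ sagle3 rep3 tens3]] lam].
- have coefs lam := (embedding_tensorP char_k _ _ _).1 (deform lam).
  have sagle x y z t := (cubic_eq0 char_k _ _ _ _).1 (fun lam =>
    let: And4 _ s _ _ := coefs lam in
    etrans (esym (sagle_defect_deform lam br omega x y z t)) (s x y z t)).
  have rep x y z m := (cubic_eq0 char_k _ _ _ _).1 (fun lam =>
    let: And4 _ _ r _ := coefs lam in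
    etrans (esym (representation_defect_deform lam br rho omega nu x y z m))
           (r x y z m)).
  have tens m n := (cubic_eq0 char_k _ _ _ _).1 (fun lam =>
    let: And4 _ _ _ e := coefs lam in
    etrans (esym (tensor_defect_deform lam br rho T omega nu theta m n))
           (e m n)).
  split; first split; split=> //.
  + by move=> x y z t; case: (sagle x y z t).
  + by move=> x y z m; case: (rep x y z m).
  + by move=> m n; case: (tens m n).
  + by move=> x y z t; case: (sagle x y z t).
  + by move=> x y z m; case: (rep x y z m).
  + by move=> m n; case: (tens m n).
  + by move=> x y z t; case: (sagle x y z t).
  + by move=> x y z m; case: (rep x y z m).
  + by move=> m n; case: (tens m n).
- apply: (embedding_tensorP char_k _ _ _).2; split.
  + (* Skew-symmetry is the one condition that is linear in the bracket. *)
    move=> x y; rewrite /= /deform2 (skew_br x y) (skew_omega x y).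
    by rewrite scalerN opprD.
  + move=> x y z t; rewrite sagle_defect_deform.
    exact: (cubic_eq0 char_k _ _ _ _).2.
  + move=> x y z m; rewrite representation_defect_deform.
    exact: (cubic_eq0 char_k _ _ _ _).2.
  + move=> m n; rewrite tensor_defect_deform.
    exact: (cubic_eq0 char_k _ _ _ _).2.
Qed.
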